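(* Let $g \ge 2$ be a natural number, and let $D$ be a digraph with digirth $\vec{g}(D) \ge 2g-1$ and maximum degree $\Delta$. Then $$\vec{\chi}(D) \le \left(\frac{1}{3}+\frac{1}{3g}\right)\Delta+(g+1).$$
   Context: All digraphs are finite and have no loops and no parallel arcs (two oppositely oriented arcs between the same pair of vertices are allowed). The maximum degree $\Delta = \Delta(D)$ is the maximum, over vertices $v$, of the degree of $v$ in the underlying graph, i.e. $d^+(v)+d^-(v)$. The digirth $\vec{g}(D)$ is the length of a shortest directed cycle in $D$, with $\vec{g}(D)=\infty$ if $D$ is acyclic (has no directed cycle). A vertex set $X\subseteq V(D)$ is acyclic if the induced subdigraph $D[X]$ contains no directed cycle. The dichromatic number $\vec{\chi}(D)$ is the smallest number $k$ such that $V(D)$ can be partitioned into $k$ acyclic sets. *)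

(* Defs.v *)
From mathcomp Require Import all_boot.

Set Implicit Arguments.
Unset Strict Implicit.
Unset Printing Implicit Defensive.

(* [arc] being a relation excludes parallel arcs, but allows both [arc x y]
   and [arc y x]. *)
Record digraph := Digraph {
  vertex :> finType;
  arc : rel vertex;
  arc_irr : irreflexive arc
}.

Section Digraph.
Variable D : digraph.
Implicit Types (X : {set D}) (P : {set {set D}}) (c : seq D) (v : D).

Definition outdeg v := #|[set w : D | arc v w]|.
Definition indeg v := #|[set w : D | arc w v]|.
Definition degree v := outdeg v + indeg v.
Definition max_degree := \max_(v : D) degree v.

(* [c] lists the vertices of a directed cycle in order; its length is
   [size c].  Oppositely oriented arcs form a directed cycle of length 2. *)
Definition dicycle c := (c != [::]) && ucycleb (@arc D) c.

(* Cycles have distinct vertices, so bounding their length by #|D| loses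
   nothing (see [acyclicP]). *)
Definition acyclic X :=
  [forall n : 'I_#|D|.+1, forall c : n.-tuple D,
     dicycle c ==> ~~ all (mem X) c].

Lemma acyclicP X :
  reflect (forall c, dicycle c -> ~ {subset c <= X}) (acyclic X).
Proof.
apply: (iffP idP) => [/forallP acX c cyc_c sub_c | acX].
  have uc : uniq c by case/and3P: cyc_c.
  have lt_c : size c < #|D|.+1.
    by rewrite ltnS -(card_uniqP uc) max_card.
  have /forallP/(_ (in_tuple c)) := acX (Ordinal lt_c).
  by rewrite /= cyc_c /= => /negP; apply; apply/allP.
apply/forallP=> n; apply/forallP=> c; apply/implyP=> cyc_c.
by apply/negP=> /allP; apply: acX.
Qed.

Definition has_dicycle_of_length n := [exists c : n.-tuple D, dicycle c].

Lemma dicycle_length_exists :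
  ~~ acyclic [set: D] -> exists n, has_dicycle_of_length n.
Proof.
rewrite negb_forall => /existsP[n]; rewrite negb_forall => /existsP[c].
by rewrite negb_imply => /andP[cyc_c _]; exists n; apply/existsP; exists c.
Qed.

(* [None] stands for infinity. *)
Definition digirth : option nat :=
  if decP (@idP (~~ acyclic [set: D])) is left cycD
  then Some (ex_minn (dicycle_length_exists cycD)) else None.

Definition digirth_geq k := if digirth is Some n then k <= n else true.

Definition acyclic_partition P :=
  partition P [set: D] && [forall X in P, acyclic X].

Definition partitionable_into k :=
  [exists P : {set {set D}}, (#|P| == k) && acyclic_partition P].

Lemma partitionable_exists : exists k, partitionable_into k.
Proof.
pose P := [set [set x] | x : D].
exists #|P|; apply/existsP; exists P; rewrite eqxx /=; apply/andP; split.
  apply/and3P; split.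
  - apply/eqP/setP=> x; rewrite inE; apply/bigcupP; exists [set x].
      exact: imset_f.
    exact: set11.
  - apply/trivIsetP=> _ _ /imsetP[x _ ->] /imsetP[y _ ->] neq.
    by rewrite disjoints1 inE; apply: contra neq => /eqP->.
  - apply/imsetP=> -[x _ /setP/(_ x)].
    by rewrite !inE eqxx.
apply/forall_inP=> _ /imsetP[x _ ->]; apply/acyclicP=> c.
case: c => [//|y c] /and3P[_ cyc_c _] sub.
have eq_x z : z \in y :: c -> z = x by move/sub/set1P.
case: c cyc_c {sub} eq_x => [|z c]; first by rewrite /= arc_irr.
move=> /andP[+ _] eq_x; rewrite (eq_x y) ?mem_head // (eq_x z) ?arc_irr //.
by rewrite !inE eqxx orbT.
Qed.

Definition dichromatic_number := ex_minn partitionable_exists.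

End Digraph.

(* Main.v *)
Require Import Defs.
From mathcomp Require Import all_boot all_order all_algebra zify ring.

Set Implicit Arguments.
Unset Strict Implicit.
Unset Printing Implicit Defensive.

(* A partition into [k] classes with the fewest monochromatic arcs gives every
   vertex at most [Delta / k] arcs in its own class (Lovasz).  A first such
   partition into [Delta %/ (3 g) + 1] classes reduces the theorem to digraphs of
   maximum degree at most [3 g - 1], for which [g + 1] colours must suffice.

   There, take a partition into [g] classes with the fewest monochromatic arcs
   (for [g = 2] take three classes; they are acyclic at once).  Each vertex has at
   most two arcs in its class, so the monochromatic dicycles are disjoint, and each
   has at least [2 g - 1] vertices.  A vertex [v] of such a dicycle with [d_j] arcs
   to class [j] has at most [2 (d_j - 2)] of them to monochromatic dicycles:
   otherwise move [v] to class [j] and then evict an independent set of more than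
   [d_j - 2] neighbours, which saves arcs.  Summing over [j], [v] has at most
   [2 g - 2] arcs to other monochromatic dicycles.

   Finally, parts that are at least as large as the maximum degree admit an acyclic
   transversal, by Haxell's argument for independent transversals: a minimal
   family of parts without one is dominated, through both in-arcs and out-arcs, by
   fewer than twice as many vertices as there are parts.  The transversal of the
   monochromatic dicycles becomes the last colour class. *)

(** * Acyclic transversals of partitioned digraphs *)

Section AcyclicTransversal.

Variables (V L : finType).
Implicit Types (r : rel V) (A T Z : {set V}) (p : V -> L) (I S : {set L}).

Definition rel_in r T := [rel a b | [&& a \in T, b \in T & r a b]].

Definition no_cycle_in r T :=
  [forall a in T, forall b in T, r a b ==> ~~ connect (rel_in r T) b a].

(** The rank of a vertex is the number of vertices that reach it inside [T]. Along an arc from [a]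
    to [b] it grows strictly, as [b] reaches itself but not [a]. *)
Lemma no_cycle_inP r T :
  reflect (exists f : V -> nat, {in T &, forall a b, r a b -> f a < f b})
          (no_cycle_in r T).
Proof.
apply: (iffP idP) => [acT | [f fP]].
  exists (fun a => #|[set b | connect (rel_in r T) b a]|) => a b aT bT rab.
  have cab : connect (rel_in r T) a b by apply: connect1; rewrite /= aT bT.
  apply/proper_card/properP; split.
    by apply/subsetP=> d; rewrite !inE => /connect_trans; apply.
  exists b; rewrite !inE ?connect0 //.
  by move/forall_inP/(_ a aT)/forall_inP/(_ b bT)/implyP/(_ rab): acT.
apply/forall_inP=> a aT; apply/forall_inP=> b bT; apply/implyP=> rab.
apply/negP=> /connectP[c cP aE].
suff: f b <= f (last b c) by rewrite -aE leqNgt fP.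
elim: c b {aE bT rab} cP => [|d c IHc] b //= /andP[/and3P[bT dT rbd] /IHc].
exact/leq_trans/ltnW/fP.
Qed.

Definition acyclic_transversal r A p I T :=
  [&& T \subset A, [forall a in T, forall b in T, (p a == p b) ==> (a == b)],
      p @: T == I & no_cycle_in r T].

Lemma acyclic_transversalP r A p I T :
  reflect [/\ T \subset A, {in T &, injective p}, p @: T = I
            & exists f : V -> nat, {in T &, forall a b, r a b -> f a < f b}]
          (acyclic_transversal r A p I T).
Proof.
apply: (iffP and4P) => [[TA /forall_inP injp /eqP pT /no_cycle_inP fT]|].
  split=> // a b aT bT /eqP pab; apply/eqP.
  by move/forall_inP/(_ b bT)/implyP/(_ pab): (injp a aT).
case=> TA injp pT fT; split=> //; [|exact/eqP|exact/no_cycle_inP].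
apply/forall_inP=> a aT; apply/forall_inP=> b bT; apply/implyP=> /eqP pab.
by apply/eqP/injp.
Qed.

(* Eliminating a forced vertex [x]: a cycle through [x] survives as a cycle
   through a shortcut. *)
Lemma rank_add_vertex r r' x T (f : V -> nat) :
    ~~ r x x -> x \notin T ->
    (forall a b, r a b -> r' a b) ->
    (forall a b, r a x -> r x b -> r' a b) ->
    {in T &, forall a b, r' a b -> f a < f b} ->
  exists f' : V -> nat, {in x |: T &, forall a b, r a b -> f' a < f' b}.
Proof.
move=> rxx xT rr' rx fP.
(* Old ranks become odd, and [x] gets the even rank [2m]. In-neighbours of [x] have old rank below
   [m]; out-neighbours have old rank at least [m], by the shortcuts through [x]. *)
pose m := \max_(a in T | r a x) (f a).+1.
exists (fun a => if a == x then m.*2 else (f a).*2.+1) => a b.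
rewrite !inE; case: (eqVneq a x) => [->|ax] /=; case: (eqVneq b x) => [->|bx] //=.
- by rewrite (negPf rxx).
- move=> _ bT rxb; rewrite ltnS leq_double; apply/bigmax_leqP=> a' /andP[a'T a'x].
  exact/fP/rx.
- move=> aT _ rax; rewrite -doubleS.
  suff: (f a).+1 <= m by rewrite -leq_double doubleS.
  by apply: (@leq_bigmax_cond _ _ (fun a => (f a).+1)); rewrite aT.
- by move=> aT bT /rr' rab; rewrite ltnS ltn_double fP.
Qed.

(* Keep as many arcs at a vertex [w] of part [i0] as possible; one more arc
   [x -> y] then closes a cycle in every transversal.  Adding the shortcuts through
   [x] and those through [y], discarding the vertices that get a loop and merging
   the parts of [x] and [y] yields a smaller instance with no transversal. *)
Lemma dominating_set_of_no_transversal r A p I i0 :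
    {in A, forall a, ~~ r a a} -> i0 \in I ->
    (exists T, acyclic_transversal r A p (I :\ i0) T) ->
    ~ (exists T, acyclic_transversal r A p I T) ->
  exists S Z, [/\ i0 \in S, S \subset I, Z \subset A, #|Z| <= 2 * (#|S| - 1)
    & {in A, forall v, p v \in S ->
        (exists2 z, z \in Z & r v z) /\ (exists2 z, z \in Z & r z v)}].
Proof.
have [n] := ubnP #|I|; elim: n => // n IHn in r A p I i0 *.
rewrite ltnS => In irrA i0I [T0 /acyclic_transversalP[T0A injT0 pT0 [f0 f0P]]] noT.
(* If part [i0] is empty, there is nothing to dominate. *)
case: (pickP [pred w in A | p w == i0]) => [w /andP[/= wA /eqP pw]|no_w]; last first.
  exists [set i0], set0; split; rewrite ?set11 ?sub1set ?sub0set ?cards0 //.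
  by move=> v vA /set1P/eqP pv; have:= no_w v; rewrite /= vA pv.
(* All arcs avoiding [w] are kept; arcs at [w] are kept only if listed in [B]. With [B] empty, [w]
   is isolated and extends [T0]. *)
pose rB (B : {set V * V}) : rel V :=
  fun a b => r a b && ((a != w) && (b != w) || ((a, b) \in B)).
pose P B := [exists T, acyclic_transversal (rB B) A p I T].
have P0 : P set0.
  apply/existsP; exists (w |: T0).
  have wT0 : {in T0, forall a, p a != i0}.
    by move=> a aT; have := imset_f p aT; rewrite pT0 => /setD1P[].
  apply/acyclic_transversalP; split.
  - by rewrite subUset sub1set wA.
  - move=> a b /setU1P[->|aT] /setU1P[->|bT] // pab; last exact: injT0.
      by have := wT0 _ bT; rewrite -pab pw eqxx.
    by have := wT0 _ aT; rewrite pab pw eqxx.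
  - by rewrite imsetU1 pT0 pw setD1K.
  - exists f0 => a b aT bT /andP[rab]; rewrite inE orbF => /andP[aw bw].
    move: aT bT; rewrite !inE (negPf aw) (negPf bw) /= => aT bT.
    exact: f0P.
have [B /maxsetP[/existsP[T atT] maxB] _] := maxset_exists P0.
have /acyclic_transversalP[TA injT pT [f fP]] := atT.
have [[x y] /and3P[/= rxy wxy xyB]] : exists e : V * V,
    [&& r e.1 e.2, (e.1 == w) || (e.2 == w) & e \notin B].
  apply/existsP; apply: contraT => /existsPn allB; case: noT; exists T.
  apply/acyclic_transversalP; split=> //; exists f => a b aT bT rab.
  apply: fP => //; rewrite /rB rab /=; have := allB (a, b); rewrite /= rab /=.
  by rewrite negb_and negb_or negbK; case: (_ && _).
pose r1 := rB ((x, y) |: B).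
have noT1 T1 : ~~ acyclic_transversal r1 A p I T1.
  apply/negP=> at1; have: (x, y) |: B = B.
    by apply: maxB; [apply/existsP; exists T1 | apply: subsetUr].
  by move/setP/(_ (x, y)); rewrite !inE eqxx (negPf xyB).
have sub_r1 a b : r1 a b -> r a b by case/andP.
have r1E a b : r1 a b -> rB B a b \/ (a = x /\ b = y).
  case/andP=> rab; rewrite in_setU1;
  case: ((a, b) =P (x, y)) => [[-> ->]|_]; first by right.
  by rewrite /= => h; left; rewrite /rB rab.
(* Otherwise the new arc would lie outside [T], and [T] would still be acyclic for [r1]. *)
have [xT yT] : x \in T /\ y \in T.
  apply/andP; apply: contraT => nxy; have /negP[] := noT1 T.
  apply/acyclic_transversalP; split=> //; exists f => a b aT bT /r1E[|[ax byy]].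
    exact: fP.
  by rewrite -ax -byy aT bT in nxy.
have [xA yA] : x \in A /\ y \in A by split; apply: (subsetP TA).
have irr1 : {in A, forall a, ~~ r1 a a}.
  by move=> a aA; apply: contra (irrA a aA) => /sub_r1.
have xDy : x != y by apply: contraTneq rxy => ->; apply: irrA.
have pxy : p x != p y by apply: contra_neq xDy => /injT; apply.
have [pxI pyI] : p x \in I /\ p y \in I by rewrite -pT !imset_f.
(* One end of the arc is [w], in part [i0]; [j0] is the part of the other end. The merged part keeps
   the name [i0]. *)
have [j0 [j0i0 j0I pxyE]] : exists j0, [/\ j0 != i0, j0 \in I
    & forall i, (i == i0) || (i == j0) = (i == p x) || (i == p y)].
  case/orP: wxy => /eqP xw; rewrite -xw in pw.
    by exists (p y); split=> // [|i]; rewrite -pw // eq_sym.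
  by exists (p x); split=> // [|i]; rewrite -pw // orbC.
pose r2 : rel V := fun a b =>
  [|| r1 a b, r1 a x && r1 x b | r1 a y && r1 y b].
pose A2 := [set a in A | ~~ r2 a a].
pose p2 v := if p v == j0 then i0 else p v.
pose I2 := I :\ j0.
have p2E a : (p2 a == i0) = (p a == p x) || (p a == p y).
  by rewrite -pxyE /p2; case: (eqVneq (p a) j0) => _; rewrite ?eqxx ?orbT ?orbF.
have sA2 : A2 \subset A by apply/subsetP=> a; rewrite inE => /andP[].
(* Such a [T2] meets the merged part in a vertex [w'] from the part of [x] or of [y]. Adding the
   other of [x] and [y] fills the missing part, and [rank_add_vertex] keeps it acyclic: a
   transversal for [r1]. *)
have noT2 : ~ exists T2, acyclic_transversal r2 A2 p2 I2 T2.
  case=> T2 /acyclic_transversalP[T2A injT2 pT2 [f2 f2P]].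
  have /imsetP[w' w'T pw'] : i0 \in p2 @: T2 by rewrite pT2 !inE eq_sym j0i0.
  have inj2 a b : a \in T2 -> b \in T2 -> p a = p b -> a = b.
    by move=> aT bT pab; apply: injT2 => //; rewrite /p2 pab.
  have add z z' : (p w' == p z) -> z' \in A -> p z' != p z ->
      (forall i, (i == i0) || (i == j0) = (i == p z') || (i == p z)) ->
      (forall a b, r1 a z' -> r1 z' b -> r2 a b) -> False.
    move=> /eqP w'z z'A zz' zzE sh.
    have p2E' a : (p2 a == i0) = (p a == p z') || (p a == p z).
      by rewrite p2E -pxyE zzE.
    have z'T a : a \in T2 -> p a != p z'.
      move=> aT; apply/negP=> pa; have aw : a = w'.
        by apply: injT2 => //; rewrite -pw'; apply/eqP; rewrite p2E' pa.
      by move: pa; rewrite aw w'z eq_sym (negPf zz').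
    have /negP[] := noT1 (z' |: T2).
    apply/acyclic_transversalP; split.
    - by rewrite subUset sub1set z'A (subset_trans T2A).
    - move=> a b /setU1P[->|aT] /setU1P[->|bT] // pab; last exact: inj2.
        by have := z'T _ bT; rewrite pab eqxx.
      by have := z'T _ aT; rewrite pab eqxx.
    - apply/setP=> i; rewrite imsetU1 !inE; apply/orP/idP.
        case=> [/eqP->|/imsetP[a aT ->]].
          have: (p z' == i0) || (p z' == j0) by rewrite zzE eqxx.
          by case/orP=> /eqP->.
        have: p2 a \in I2 by rewrite -pT2 imset_f.
        by rewrite /p2 !inE; case: (p a =P j0) => [->|_] // /andP[].
      move=> iI; have [/eqP->|iz'] := boolP (i == p z'); first by left.
      right; have [/eqP->|iz] := boolP (i == p z); first by rewrite -w'z imset_f.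
      have := zzE i; rewrite (negPf iz') (negPf iz) => /norP[ii0 ij0].
      have: i \in p2 @: T2 by rewrite pT2 !inE ij0.
      case/imsetP=> a aT ia; apply/imsetP; exists a => //.
      by move: ia ii0; rewrite /p2; case: (p a =P j0) => // _ ->; rewrite eqxx.
    - apply: (rank_add_vertex (r' := r2) (f := f2)) => //; first exact: irr1.
        by apply/negP=> /z'T; rewrite eqxx.
      by move=> a b rab; rewrite /r2 rab.
  have: p2 w' == i0 by rewrite -pw'.
  rewrite p2E => /orP[] pwz.
  - apply: (add x y) => //; [by rewrite eq_sym | by move=> i; rewrite pxyE orbC|].
    by move=> a b ay yb; rewrite /r2 ay yb !orbT.
  - by apply: (add y x) => // a b ax xb; rewrite /r2 ax xb orbT.
(* [T] without [x] and [y] works with the same ranks: a shortcut used there consists of two arcs of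
   [rB B] inside [T], both increasing [f]. In particular no remaining vertex has a loop. *)
have atT2 : exists T2, acyclic_transversal r2 A2 p2 (I2 :\ i0) T2.
  have lt_f a b : a \in T :\ x :\ y -> b \in T :\ x :\ y -> r2 a b -> f a < f b.
    rewrite !inE => /and3P[ay ax aT] /and3P[b_y bx bT].
    have lt1 c d : c \in T -> d \in T -> (c != x) || (d != y) -> r1 c d -> f c < f d.
      by move=> cT dT cd /r1E[/fP->//|[cx dy]]; rewrite cx dy !eqxx in cd.
    case/or3P=> [|/andP[az zb]|/andP[az zb]]; first by apply: lt1; rewrite ?ax.
      by apply: (@ltn_trans (f x)); apply: lt1; rewrite ?ax ?b_y ?orbT.
    by apply: (@ltn_trans (f y)); apply: lt1; rewrite ?ax ?b_y ?orbT // eq_sym xDy.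
  have p2T a : a \in T :\ x :\ y -> p2 a = p a /\ p2 a != i0.
    rewrite !inE => /and3P[ay ax aT]; have: ~~ ((p a == i0) || (p a == j0)).
      by rewrite pxyE !(inj_in_eq injT) // negb_or ax.
    by rewrite /p2 => /norP[a0 /negPf->].
  exists (T :\ x :\ y); apply/acyclic_transversalP; split.
  - apply/subsetP=> a aT; rewrite inE; move: (aT).
    rewrite !inE => /and3P[_ _ /(subsetP TA)->] /=.
    by apply/negP=> /(lt_f _ _ aT aT); rewrite ltnn.
  - move=> a b aT bT; rewrite (proj1 (p2T _ aT)) (proj1 (p2T _ bT)).
    by move: aT bT; rewrite !inE => /and3P[_ _ aT] /and3P[_ _ bT]; apply: injT.
  - apply/setP=> i; rewrite !inE; apply/imsetP/and3P.
      case=> a aT ->; have [pa pi0] := p2T a aT; split=> //.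
        by have:= pi0; rewrite p2E -pxyE => /norP[_]; rewrite pa.
      by rewrite pa -pT imset_f //; move: aT; rewrite !inE => /and3P[].
    case=> ii0 ij0; rewrite -pT => /imsetP[a aT ia].
    have aT2 : a \in T :\ x :\ y.
      have:= pxyE i; rewrite (negPf ii0) (negPf ij0) ia => /esym/norP[ax ay].
      rewrite !inE aT andbT; apply/andP; split.
        by apply: contraNneq ay => ->.
      by apply: contraNneq ax => ->.
    by exists a => //; rewrite (proj1 (p2T _ aT2)).
  - by exists f => a b aT bT; apply: lt_f.
have I2n : #|I2| < n.
  by move: In; rewrite (cardsD1 j0) j0I /=.
have irr2 : {in A2, forall a, ~~ r2 a a} by move=> a; rewrite inE => /andP[].
have i0I2 : i0 \in I2 by rewrite !inE eq_sym j0i0.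
have [S2 [Z2 [i0S SI ZA cZ domZ]]] := IHn r2 A2 p2 I2 i0 I2n irr2 i0I2 atT2 noT2.
exists (j0 |: S2), (x |: (y |: Z2)); split.
- by rewrite inE i0S orbT.
- by rewrite subUset sub1set j0I (subset_trans SI) // subsetDl.
- by rewrite !subUset !sub1set xA yA (subset_trans ZA).
- have j0S : j0 \notin S2 by apply/negP=> /(subsetP SI); rewrite !inE eqxx.
  have S2gt0 : 0 < #|S2| by apply/card_gt0P; exists i0.
  have le2 : #|x |: (y |: Z2)| <= 2 + #|Z2|.
    by rewrite !cardsU1 addnA leq_add2r; do 2!case: (_ \notin _).
  rewrite (cardsU1 j0 S2) j0S (leq_trans le2) //.
  by clear - cZ S2gt0; lia.
- move=> v vA pv.
  have zx : x \in x |: (y |: Z2) by rewrite !inE eqxx.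
  have zy : y \in x |: (y |: Z2) by rewrite !inE eqxx orbT.
  have p2v : p2 v \in S2.
    by move: pv; rewrite /p2 !inE; case: (p v =P j0).
  have [vA2|vA2] := boolP (v \in A2).
    have [[z zZ vz] [z' zZ' z'v]] := domZ v vA2 p2v.
    split.
      (* A shortcut to [z] starts with a genuine arc to [x] or [y], which is in the enlarged set. *)
      case/or3P: vz => [/sub_r1 vz|/andP[/sub_r1 vx _]|/andP[/sub_r1 vy _]].
      - by exists z => //; rewrite !inE zZ !orbT.
      - by exists x.
      - by exists y.
    case/or3P: z'v => [/sub_r1 z'v|/andP[_ /sub_r1 vx]|/andP[_ /sub_r1 vy]].
    - by exists z' => //; rewrite !inE zZ' !orbT.
    - by exists x.
    - by exists y.
  (* A discarded vertex has a loop made of arcs to and from [x], or to and from [y], so that single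
     vertex dominates it both ways. *)
  move: vA2; rewrite inE vA negbK /= /r2 (negPf (irr1 _ vA)) /=.
  case/orP=> /andP[/sub_r1 h1 /sub_r1 h2].
    by split; exists x.
  by split; exists y.
Qed.

(** Double counting on a minimal subfamily without a transversal. The at least [s * #|S|] vertices
    in the parts of [S] each have an arc to [Z] and an arc from [Z], giving [2 * s * #|S|] arcs,
    whereas [Z] carries at most [s * #|Z|], which is at most [2 * s * (#|S| - 1)]. *)
Lemma acyclic_transversal_exists r A p I s :
    0 < s -> {in A, forall a, ~~ r a a} ->
    {in I, forall i, s <= #|[set a in A | p a == i]|} ->
    {in A, forall z, \sum_(a in A) (r a z + r z a) <= s} ->
  exists T, acyclic_transversal r A p I T.
Proof.
move=> s_gt0 irrA sizeI degA; apply/existsP; apply: contraT => noT.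
pose P (J : {set L}) := (J \subset I) && ~~ [exists T, acyclic_transversal r A p J T].
have [] := @minset_exists _ P I; first by rewrite /P subxx.
move=> J /minsetP[/andP[JI noJ] minJ] _.
have /set0Pn[i0 i0J] : J != set0.
  apply: contra noJ => /eqP->; apply/existsP; exists set0.
  apply/acyclic_transversalP; split; rewrite ?sub0set ?imset0 //.
    by move=> a b; rewrite inE.
  by exists (fun=> 0) => a b; rewrite inE.
have atJ : exists T, acyclic_transversal r A p (J :\ i0) T.
  apply/existsP; apply: contraT => noJ'.
  have: J :\ i0 = J by apply: minJ; rewrite /P ?subsetDl // (subset_trans _ JI) ?subsetDl.
  by move/setP/(_ i0); rewrite !inE eqxx i0J.
have [S [Z [i0S SJ ZA cZ domZ]]] : exists S Z,
    [/\ i0 \in S, S \subset J, Z \subset A, #|Z| <= 2 * (#|S| - 1)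
    & {in A, forall v, p v \in S ->
        (exists2 z, z \in Z & r v z) /\ (exists2 z, z \in Z & r z v)}].
  apply: dominating_set_of_no_transversal => //; by move/existsP; apply/negP.
have up : \sum_(z in Z) \sum_(a in A) (r a z + r z a) <= #|Z| * s.
  by rewrite -sum_nat_const; apply: leq_sum => z /(subsetP ZA)/degA.
have lo : #|S| * (2 * s) <= \sum_(z in Z) \sum_(a in A) (r a z + r z a).
  rewrite exchange_big /= -sum_nat_const.
  apply: (@leq_trans (\sum_(i in S) \sum_(a in A | p a == i) 2)).
    apply: leq_sum => i iS; have iI := subsetP (subset_trans SJ JI) i iS.
    rewrite sum_nat_cond_const mulnC leq_mul2r; apply: leq_trans (sizeI i iI) _.
    by apply: subset_leq_card; apply/subsetP=> a; rewrite !inE.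
  rewrite [leqRHS](bigID (fun a => p a \in S)) /=.
  rewrite (partition_big p (mem S)) /=; last by move=> a /andP[].
  apply: leq_trans (leq_addr _ _).
  apply: leq_sum => i iS.
  rewrite (eq_bigl (fun a => [&& a \in A, p a \in S & p a == i])); last first.
    by move=> a; case: eqP => [->|]; rewrite ?iS ?andbF.
  rewrite [leqRHS](eq_bigl (fun a => [&& a \in A, p a \in S & p a == i])); last first.
    by move=> a; rewrite -andbA.
  apply: leq_sum => a /and3P[aA paS _].
  have [[z zZ az] [z' z'Z z'a]] := domZ a aA paS.
  rewrite big_split /=.
  apply: (@leq_add 1 1).
    by rewrite (bigD1 z) //= az.
  by rewrite (bigD1 z') //= z'a.
have Sgt0 : 0 < #|S| by apply/card_gt0P; exists i0.
clear - cZ up lo Sgt0 s_gt0; nia.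
Qed.

End AcyclicTransversal.

(** * Partitions with the fewest monochromatic arcs *)

Section Energy.

Variables (V C : finType) (r : rel V).
Implicit Types (phi psi : {ffun V -> C}) (u v w : V) (l j : C).

Definition arcs_between u v := r u v + r v u.
Definition total_degree u := \sum_w arcs_between u w.
Definition class_degree phi l u := \sum_(w | phi w == l) arcs_between u w.
(** Each monochromatic arc is counted at both ends, whence the factors 2 below. *)
Definition energy phi := \sum_u class_degree phi (phi u) u.
Definition recolour phi u l := [ffun w => if w == u then l else phi w].
Definition min_energy phi := forall psi, energy phi <= energy psi.

Lemma arcs_betweenC u v : arcs_between u v = arcs_between v u.
Proof. exact: addnC. Qed.

Lemma sum_class_degree phi u : \sum_l class_degree phi l u = total_degree u.
Proof. by rewrite /total_degree (partition_big phi predT). Qed.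

Lemma exists_small_class phi t u :
  total_degree u < #|C| * t.+1 -> exists l, class_degree phi l u <= t.
Proof.
move=> deg_u; apply/existsP; apply: contraTT deg_u => /existsPn large.
rewrite -leqNgt -(sum_class_degree phi) -sum_nat_const leq_sum // => l _.
by rewrite ltnNge.
Qed.

Lemma exists_min_energy (l0 : C) : exists phi, min_energy phi.
Proof.
have [phi _ phiP] := @arg_minnP _ [ffun=> l0] xpredT energy isT.
by exists phi => psi; apply: phiP.
Qed.

Hypothesis r_irr : irreflexive r.

Lemma arcs_betweenxx u : arcs_between u u = 0.
Proof. by rewrite /arcs_between r_irr. Qed.

Lemma class_degree_recolour phi u l j v :
  arcs_between v u = 0 -> class_degree (recolour phi u l) j v = class_degree phi j v.
Proof.
move=> vu; rewrite /class_degree !(big_mkcond (fun w => _ == _)) /=.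
apply: eq_bigr => w _; rewrite ffunE; case: (w =P u) => // ->.
by rewrite vu !if_same.
Qed.

Lemma class_degree_recolour_in phi u j v :
  phi u != j ->
  class_degree (recolour phi u j) j v = class_degree phi j v + arcs_between v u.
Proof.
move=> uj; rewrite /class_degree !(big_mkcond (fun w => _ == _)) /=.
rewrite (bigD1 u) //= [X in _ = X + _](bigD1 u) //= ffunE !eqxx (negPf uj) add0n addnC.
by congr (_ + _); apply: eq_bigr => w /negPf wu; rewrite ffunE wu.
Qed.

(** Isolates the contribution of [u]; the remaining double sum does not depend on the colour of
    [u]. *)
Lemma energyE phi u :
  energy phi = 2 * class_degree phi (phi u) u +
    \sum_(a | a != u) \sum_(w | (w != u) && (phi w == phi a)) arcs_between a w.
Proof.
rewrite /energy (bigD1 u) //= mul2n -addnn -addnA; congr (_ + _).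
have split_u a : class_degree phi (phi a) a = (phi a == phi u) * arcs_between a u +
    \sum_(w | (w != u) && (phi w == phi a)) arcs_between a w.
  rewrite /class_degree big_mkcond (bigD1 u) //= [in RHS]big_mkcondr /=.
  by congr (_ + _); rewrite eq_sym; case: (_ == _); rewrite ?mul1n.
under eq_bigr do rewrite split_u.
rewrite big_split /=; congr (_ + _).
rewrite /class_degree [RHS]big_mkcond [RHS](bigD1 u) //= eqxx arcs_betweenxx add0n.
apply: eq_bigr => a _.
by rewrite arcs_betweenC; case: (_ == _); rewrite ?mul1n.
Qed.

Lemma energy_recolour phi u l :
  energy (recolour phi u l) + 2 * class_degree phi (phi u) u =
  energy phi + 2 * class_degree phi l u.
Proof.
rewrite (energyE phi u) (energyE (recolour phi u l) u).
rewrite class_degree_recolour ?arcs_betweenxx // ffunE eqxx.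
rewrite addnAC [RHS]addnAC; congr (_ + _); first exact: addnC.
apply: eq_bigr => a /negPf au; apply: eq_bigl => w.
by case: (eqVneq w u) => //= /negPf wu; rewrite !ffunE au wu.
Qed.

Lemma min_energy_class_degree phi u l :
  min_energy phi -> class_degree phi (phi u) u <= class_degree phi l u.
Proof.
by move=> /(_ (recolour phi u l)) min_phi; have := energy_recolour phi u l; lia.
Qed.

Lemma min_energy_own_degree phi t u :
    min_energy phi -> total_degree u < #|C| * t.+1 ->
  class_degree phi (phi u) u <= t.
Proof.
move=> min_phi /(exists_small_class phi)[l]; apply: leq_trans.
exact: min_energy_class_degree.
Qed.

(** Each vertex of [s] has more than [t] arcs in class [j] and at most [t] in some class, so moving
    it there saves an arc. By independence, earlier moves do not change the class degrees of later
    vertices. *)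
Lemma evict_independent (s : seq V) phi j t :
    (forall u, total_degree u < #|C| * t.+1) -> uniq s ->
    {in s, forall u, phi u = j /\ t < class_degree phi j u} ->
    {in s &, forall u v, arcs_between u v = 0} ->
  exists psi, energy psi + 2 * size s <= energy phi.
Proof.
move=> deg; elim: s phi => [|u s IHs] phi /=; first by exists phi; rewrite addn0.
case/andP=> us uniq_s phis indep.
have [phiu degu] := phis u (mem_head u s).
have [l lu] := exists_small_class phi (deg u).
have [//|w ws|v w vs ws|psi psiP] := IHs (recolour phi u l).
- have [phiw degw] := phis w (mem_behead (s := u :: s) ws).
  have wu : w != u by apply: contraNneq us => <-.
  rewrite ffunE (negPf wu) class_degree_recolour //.
  by apply: indep; rewrite inE ?eqxx ?ws ?orbT.
- by apply: indep; rewrite inE ?vs ?ws orbT.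
exists psi; have := energy_recolour phi u l; rewrite phiu; lia.
Qed.

(* Moving [v] to class [j] costs [class_degree phi j v - t]; each neighbour
   in [s] then has more than [t] arcs in its class and gains at least [1] by
   leaving. *)
Lemma min_energy_independent phi v j t (s : seq V) :
    (forall u, total_degree u < #|C| * t.+1) -> min_energy phi ->
    phi v != j -> class_degree phi (phi v) v = t -> uniq s ->
    {in s, forall u,
      [/\ phi u = j, class_degree phi j u = t & 0 < arcs_between u v]} ->
    {in s &, forall u w, arcs_between u w = 0} ->
  size s + t <= class_degree phi j v.
Proof.
move=> deg min_phi vj degv uniq_s sP indep.
have [u|psi psiP] := @evict_independent s (recolour phi v j) j t deg uniq_s _ indep.
  case/sP=> phiu degu uv; rewrite class_degree_recolour_in // ffunE degu phiu if_same.
  by rewrite -addn1 leq_add2l.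
have := energy_recolour phi v j; have := min_phi psi; rewrite degv; lia.
Qed.

End Energy.

(** * Colouring digraphs of small maximum degree *)

Section Colouring.

Variables (V : finType) (r : rel V).

Definition monochromatic_acyclic (C : Type) (psi : V -> C) :=
  forall c l, c != [::] -> ucycleb r c -> {in c, forall v, psi v = l} -> False.

Lemma ranked_no_cycle (T : {set V}) (f : V -> nat) c :
  {in T &, forall a b, r a b -> f a < f b} ->
  c != [::] -> cycle r c -> {subset c <= T} -> False.
Proof.
move=> fP; have lt_last s y : path r y s -> s != [::] -> {subset y :: s <= T} ->
    f y < f (last y s).
  elim: s y => // z s IHs y /= /andP[ryz rs] _ sT.
  have fyz : f y < f z by apply: fP => //; apply: sT; rewrite !inE eqxx ?orbT.
  case: s => [//|z' s] in IHs rs sT *; apply: ltn_trans fyz _.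
  by apply: IHs => // w ws; apply: sT; rewrite inE ws orbT.
case: c => // x c _ /= /lt_last ltx cT.
suff: f x < f (last x (rcons c x)) by rewrite last_rcons ltnn.
apply: ltx; first by rewrite -size_eq0 size_rcons.
by move=> y; rewrite -rcons_cons mem_rcons inE => /predU1P[->|/cT //]; rewrite cT ?mem_head.
Qed.

Hypothesis r_irr : irreflexive r.

(** With minimum energy each vertex has at most one arc in its class, while a dicycle uses an in-arc
    and an out-arc at each of its vertices. *)
Lemma low_degree_colouring k :
  (forall u, total_degree r u < k.+1 * 2) ->
  exists psi : V -> 'I_k.+1, monochromatic_acyclic psi.
Proof.
move=> deg; have [phi min_phi] := exists_min_energy r (ord0 : 'I_k.+1).
exists phi => c l; case Ec: c => [//|v c'] _; rewrite -Ec => /andP[cyc_c _] cl.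
have v_c : v \in c by rewrite Ec mem_head.
have out : r v (next c v) by apply: next_cycle.
have inn : r (prev c v) v by apply: prev_cycle.
have phi_out : phi (next c v) == phi v by rewrite !cl ?mem_next.
have phi_in : phi (prev c v) == phi v by rewrite !cl ?mem_prev.
have := min_energy_own_degree (t := 1) r_irr (u := v) min_phi.
rewrite card_ord => /(_ (deg v)); rewrite /class_degree big_split.
rewrite (bigD1 (next c v)) //= (bigD1 (prev c v) (P := fun i => phi i == phi v)) //=.
by rewrite out inn addnCA.
Qed.

(** * Monochromatic dicycles of a minimum-energy partition *)

Variable g : nat.
Hypothesis g_ge3 : 3 <= g.
Hypothesis deg_r : forall u, total_degree r u < 3 * g.
Hypothesis girth_r : forall c, c != [::] -> ucycleb r c -> 2 * g - 1 <= size c.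

Variable phi : {ffun V -> 'I_g}.
Hypothesis min_phi : min_energy r phi.

Let deg3 u : total_degree r u < #|'I_g| * 3.
Proof. by rewrite card_ord mulnC. Qed.

Definition mono_arc : rel V := fun u w => r u w && (phi u == phi w).

Definition cyclic_vertices :=
  [set v | [exists w, mono_arc v w && connect mono_arc w v]].
Notation B := cyclic_vertices.

(** The default [v] off the monochromatic dicycles makes this an injection of the whole vertex set,
    whose orbits on [B] are those dicycles. *)
Definition cycle_succ v :=
  if [pick w | mono_arc v w && connect mono_arc w v] is Some w then w else v.
Notation sigma := cycle_succ.

Lemma connect_headP (e : rel V) x y :
  connect e x y -> x != y -> exists2 z, e x z & connect e z y.
Proof.
case/connectP=> -[|z s] /=; first by move=> _ ->; rewrite eqxx.
by case/andP=> xz zs yE _; exists z => //; apply/connectP; exists s.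
Qed.

Lemma connect_lastP (e : rel V) x y :
  connect e x y -> x != y -> exists2 z, connect e x z & e z y.
Proof.
case/connectP=> s; case/lastP: s => [|s z] /=; first by move=> _ ->; rewrite eqxx.
rewrite rcons_path last_rcons => /andP[xs sz] -> _.
by exists (last x s) => //; apply/connectP; exists s.
Qed.

Lemma mono_arc_neq u w : mono_arc u w -> u != w.
Proof. by case/andP=> ruw _; apply: contraTneq ruw => ->; rewrite r_irr. Qed.

Lemma cycle_succP v : v \in B -> mono_arc v (sigma v) /\ sigma v \in B.
Proof.
rewrite inE /cycle_succ => /existsP[w0 w0P].
case: pickP => [w /andP[vw wv]|/(_ w0)]; last by rewrite w0P.
split=> //; have wDv : w != v by rewrite eq_sym mono_arc_neq.
have [z wz zv] := connect_headP wv wDv.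
by rewrite inE; apply/existsP; exists z; rewrite wz (connect_trans zv) ?connect1.
Qed.

Lemma cyclic_pred v : v \in B -> exists u, mono_arc u v.
Proof.
rewrite inE => /existsP[w /andP[vw wv]].
have [|z _ zv] := connect_lastP wv; first by rewrite eq_sym mono_arc_neq.
by exists z.
Qed.

(** Minimality allows at most two arcs in the own class, and the dicycle already supplies one in
    each direction. *)
Lemma cyclic_degrees v : v \in B ->
  [/\ class_degree r phi (phi v) v = 2,
      \sum_(w | phi w == phi v) r v w = 1 & \sum_(w | phi w == phi v) r w v = 1].
Proof.
move=> vB; have := min_energy_own_degree r_irr min_phi (deg3 v).
rewrite /class_degree big_split /=.
have [/andP[vw /eqP phiw] _] := cycle_succP vB.
have [u /andP[uv /eqP phiu]] := cyclic_pred vB.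
have : 0 < \sum_(w | phi w == phi v) r v w.
  by rewrite (bigD1 (sigma v)) /= ?vw // phiw.
have : 0 < \sum_(w | phi w == phi v) r w v.
  by rewrite (bigD1 u) /= ?uv // phiu.
move: (\sum_(w | _) r v w) (\sum_(w | _) r w v) => m n *.
by split; lia.
Qed.

Lemma sum_bool_unique (P b : pred V) u w :
  \sum_(a | P a) b a = 1 -> P u -> P w -> b u -> b w -> u = w.
Proof.
move=> sum1 Pu Pw bu bw; apply/eqP; apply: contraT => uw; move: sum1.
by rewrite (bigD1 u) //= (bigD1 w) /= ?bu ?bw // Pw eq_sym.
Qed.

Lemma cycle_succ_unique v w : v \in B -> mono_arc v w -> w = sigma v.
Proof.
move=> vB /andP[vw /eqP phiw]; have [_ out1 _] := cyclic_degrees vB.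
have [/andP[vs /eqP phis] _] := cycle_succP vB.
by apply: sum_bool_unique out1 _ _ vw vs; rewrite -?phiw -?phis.
Qed.

Lemma cycle_succ_inj : injective sigma.
Proof.
have notB v : v \notin B -> sigma v = v.
  rewrite inE => /existsPn noB; rewrite /cycle_succ; case: pickP => // w.
  by rewrite (negPf (noB w)).
move=> a b; have [aB|aB] := boolP (a \in B); have [bB|bB] := boolP (b \in B).
- have [aa saB] := cycle_succP aB; have [bb _] := cycle_succP bB => eq_s.
  have [_ _ in1] := cyclic_degrees saB; rewrite -eq_s in bb.
  case/andP: aa => ra pa; case/andP: bb => rb pb.
  exact: sum_bool_unique in1 pa pb ra rb.
- by rewrite (notB b) // => sab; have [_] := cycle_succP aB; rewrite sab (negPf bB).
- by rewrite (notB a) // => sab; have [_] := cycle_succP bB; rewrite -sab (negPf aB).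
- by rewrite !notB.
Qed.

Lemma orbit_cyclic v u : v \in B -> u \in orbit sigma v -> u \in B.
Proof.
rewrite -fconnect_orbit => vB /iter_findex <-; elim: (findex _ _ _) => //= n.
by case/cycle_succP.
Qed.

Lemma order_cycle_succ v : v \in B -> 2 * g - 1 <= order sigma v.
Proof.
move=> vB; rewrite -size_orbit; apply: girth_r.
  by rewrite -size_eq0 size_orbit -lt0n order_gt0.
rewrite /ucycleb orbit_uniq andbT.
apply: (@sub_in_cycle _ (mem B) (frel sigma)).
- by move=> a b aB _ /eqP <-; have [/andP[]] := cycle_succP aB.
- by apply/allP=> u; apply: orbit_cyclic.
- exact: cycle_orbit cycle_succ_inj _.
Qed.

Lemma arcs_between_le1 u v : arcs_between r u v <= 1.
Proof.
rewrite /arcs_between; case uv: (r u v); case vu: (r v u) => //.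
have := @girth_r [:: u; v] isT; rewrite /ucycleb /= uv vu /= inE.
have -> : u != v by apply: contraTneq uv => ->; rewrite r_irr.
by move/(_ isT); lia.
Qed.

(** Minimality gives [v] at least 2 arcs to each class, as it has 2 to its own. This leaves at most
    [(3g - 1) - 2(g - 1) = g + 1] for class [j]. *)
Lemma cyclic_class_degree_bound v (j : 'I_g) :
  v \in B -> class_degree r phi j v <= g + 1.
Proof.
move=> vB; have := deg_r v; rewrite -(sum_class_degree r phi) (bigD1 j) //=.
have : \sum_(l < g | l != j) 2 <= \sum_(l < g | l != j) class_degree r phi l v.
  apply: leq_sum => l _; have [<- _ _] := cyclic_degrees vB.
  exact: min_energy_class_degree.
rewrite sum_nat_cond_const.
have -> : #|[set l : 'I_g | l != j]| = g.-1.
  by rewrite -[in RHS](card_ord g) -(cardsC1 j); apply: eq_card => l; rewrite !inE.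
by move: (\sum_(l < g | _) _) (class_degree _ _ _ _) => m n; clear - g_ge3; lia.
Qed.

(* The neighbours of [v] on monochromatic cycles of class [j] cannot fill a
   whole cycle, so they split into two independent sets by the parity of their
   distance to the next vertex of the cycle that is not a neighbour. *)
Lemma cyclic_neighbours_bound v j : v \in B -> phi v != j ->
  #|[set a in B | (phi a == j) && (0 < arcs_between r a v)]| + 4
    <= 2 * class_degree r phi j v.
Proof.
move=> vB vj; set N := [set a in B | _].
have NB a : a \in N -> [/\ a \in B, phi a = j & 0 < arcs_between r a v].
  by rewrite inE => /and3P[-> /eqP].
have N_small : #|N| <= g + 1.
  apply: leq_trans (cyclic_class_degree_bound j vB).
  rewrite -sum1_card /class_degree (big_mkcond (mem N)) (big_mkcond (fun w => _ == j)) /=.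
  apply: leq_sum => a _; case: ifP => // /NB[_ -> av].
  by rewrite eqxx arcs_betweenC.
(* A dicycle has at least [2g - 1] vertices, which exceeds [g + 1] because [g >= 3]. *)
have exits a : exists k, iter k sigma a \notin N.
  have [aN|aN] := boolP (a \in N); last by exists 0.
  have [aB _ _] := NB a aN.
  have /allPn[u] : ~~ all (mem N) (orbit sigma a).
    apply/negP=> /allP orbN.
    have orb_le : order sigma a <= #|N|.
      by rewrite -size_orbit -(card_uniqP (orbit_uniq _ _)); apply/subset_leq_card/subsetP.
    have := leq_trans (leq_trans (order_cycle_succ aB) orb_le) N_small.
    by clear - g_ge3; lia.
  by rewrite -fconnect_orbit => /iter_findex <- uN; exists (findex sigma a u).
pose h a := ex_minn (exits a).
have hS a : a \in N -> h a = (h (sigma a)).+1.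
  move=> aN; rewrite /h; case: ex_minnP => -[|k] kN mink; first by rewrite aN in kN.
  case: ex_minnP => k' k'N mink'; apply/eqP; rewrite eqSS eqn_leq.
  by rewrite mink' -?iterSr // andbT -ltnS mink // iterSr.
pose O := [set a | odd (h a)].
(* An arc inside [M] would be a step of [sigma], and by [hS] such a step changes the parity of
   [h]. *)
have indep (M : {set V}) : M \subset N ->
    {in M &, forall a b, odd (h a) = odd (h b)} -> #|M| + 2 <= class_degree r phi j v.
  move=> MN oddM; rewrite cardE.
  apply: (min_energy_independent r_irr deg3 min_phi vj); rewrite ?enum_uniq //.
  - by case: (cyclic_degrees vB).
  - move=> u; rewrite mem_enum => /(subsetP MN)/NB[uB <- uv]; split=> //.
    by case: (cyclic_degrees uB).
  have no_arc a b : a \in M -> b \in M -> r a b = false.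
    move=> aM bM; apply/negP=> rab.
    have [[aB ja _] [bB jb _]] := (NB a (subsetP MN _ aM), NB b (subsetP MN _ bM)).
    have bE : b = sigma a by apply: cycle_succ_unique; rewrite // /mono_arc rab ja jb eqxx.
    have := oddM _ _ aM bM; rewrite (hS a) ?(subsetP MN) // -bE /=.
    by case: (odd _).
  by move=> a b; rewrite !mem_enum /arcs_between => aM bM; rewrite !no_arc.
have := cardsID O N.
have c1 : #|N :&: O| + 2 <= class_degree r phi j v.
  apply: indep => [|a b]; first exact: subsetIl.
  by rewrite !inE => /andP[_ ->] /andP[_ ->].
have c2 : #|N :\: O| + 2 <= class_degree r phi j v.
  apply: indep => [|a b]; first exact: subsetDl.
  by rewrite !inE => /andP[/negPf-> _] /andP[/negPf-> _].
clear - c1 c2; lia.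
Qed.

(** * Breaking the monochromatic dicycles by a transversal *)

Definition cycle_label v := froot sigma v.

Lemma cycle_labelE u v : (cycle_label u == cycle_label v) = fconnect sigma u v.
Proof. exact/root_connect/fconnect_sym/cycle_succ_inj. Qed.

Definition cross_arc : rel V :=
  fun a b => r a b && (cycle_label a != cycle_label b).

Lemma mono_arc_label a b :
  a \in B -> mono_arc a b -> cycle_label a = cycle_label b.
Proof.
move=> aB /(cycle_succ_unique aB) ->; apply/eqP; rewrite cycle_labelE.
exact: fconnect1.
Qed.

(** In the class of [v] every arc to [B] stays on the dicycle of [v], and [2 * 2 = 4]. In another
    class arcs are counted by neighbours, since there are no opposite arcs. *)
Lemma cross_class_degree v j : v \in B ->
  \sum_(a in B | phi a == j) (cross_arc a v + cross_arc v a) + 4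
    <= 2 * class_degree r phi j v.
Proof.
move=> vB; have [<-|vj] := eqVneq (phi v) j.
  have [-> _ _] := cyclic_degrees vB; rewrite big1 // => a /andP[aB /eqP phia].
  rewrite /cross_arc; case rav: (r a v); case rva: (r v a) => //=.
  - by rewrite (@mono_arc_label a v) // ?eqxx // /mono_arc rav phia eqxx.
  - by rewrite (@mono_arc_label a v) // ?eqxx // /mono_arc rav phia eqxx.
  - by rewrite (@mono_arc_label v a) // ?eqxx // /mono_arc rva phia eqxx.
apply: leq_trans (cyclic_neighbours_bound vB vj).
rewrite leq_add2r -sum1_card big_mkcond [leqRHS]big_mkcond /=.
apply: leq_sum => a _; rewrite !inE; case: ifP => // /andP[aB phia].
have: cross_arc a v + cross_arc v a <= arcs_between r a v.
  by rewrite /cross_arc leq_add //; case: (r _ _); rewrite //= leq_b1.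
rewrite aB phia /=; case: (posnP (arcs_between r a v)) => [->//|_].
by move=> /leq_trans; apply; apply: arcs_between_le1.
Qed.

(** Summing over the [g] classes gives at most [2(3g - 1) - 4g = 2g - 2], within the guaranteed
    dicycle length [2g - 1]. *)
Lemma cross_degree v : v \in B ->
  \sum_(a in B) (cross_arc a v + cross_arc v a) <= 2 * g - 1.
Proof.
move=> vB; rewrite (partition_big phi predT) //=.
have: \sum_(j < g) (\sum_(a in B | phi a == j) (cross_arc a v + cross_arc v a) + 4)
    <= \sum_(j < g) 2 * class_degree r phi j v.
  by apply: leq_sum => j _; apply: cross_class_degree.
rewrite big_split sum_nat_const card_ord -big_distrr /= sum_class_degree.
have := deg_r v; move: (total_degree r v) (\sum_(j < g) _) => m n.
by clear; lia.
Qed.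

Lemma min_energy_colouring : exists psi : V -> 'I_g.+1, monochromatic_acyclic psi.
Proof.
pose I := cycle_label @: B.
have [|a _|i /imsetP[v vB ->]|z zB|T] :=
    @acyclic_transversal_exists V V cross_arc B cycle_label I (2 * g - 1).
- by move: g_ge3; clear; lia.
- by rewrite /cross_arc eqxx andbF.
- apply: leq_trans (order_cycle_succ vB) _.
  rewrite -size_orbit -(card_uniqP (orbit_uniq _ _)).
  apply/subset_leq_card/subsetP=> u uv; rewrite inE (orbit_cyclic vB uv) eq_sym.
  by rewrite cycle_labelE fconnect_orbit.
- exact: cross_degree.
case/acyclic_transversalP=> TB injT TI [f fP].
exists (fun v => if v \in T then ord_max else widen_ord (leqnSn g) (phi v)).
move=> c l c_nil /andP[cyc_c uniq_c] cl.
have [v v_c] : exists v, v \in c.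
  by case: c c_nil {cyc_c uniq_c cl} => // v c; exists v; rewrite mem_head.
have T_c u : u \in c -> (u \in T) = (l == ord_max).
  move=> /cl; case: ifP => [_ <-|_ <-]; first by rewrite eqxx.
  by apply/esym/negP=> /eqP/(congr1 val)/= phiu; have := ltn_ord (phi u); rewrite phiu ltnn.
have [lmax|lmax] := boolP (l == ord_max).
  apply: (@ranked_no_cycle T f c _ c_nil cyc_c) => [a b aT bT rab|u u_c]; last first.
    by rewrite T_c.
  (* Distinct vertices of [T] lie on distinct dicycles, so every arc inside [T] is a cross arc. *)
  apply: fP => //; rewrite /cross_arc rab; apply: contraTneq rab => /injT ->//.
  by rewrite r_irr.
have phi_c : {in c &, forall a b, phi a = phi b}.
  move=> a b a_c b_c; have := cl a a_c; have := cl b b_c.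
  rewrite !T_c // (negPf lmax) => <- /(congr1 val) /= ab; exact: val_inj.
have mono_c : cycle mono_arc c.
  have c_c : all (mem c) c by apply/allP.
  apply: sub_in_cycle c_c cyc_c.
  by move=> a b a_c b_c rab; rewrite /mono_arc rab (phi_c a b) ?eqxx.
have cB u : u \in c -> u \in B.
  move=> u_c; rewrite inE; apply/existsP; exists (next c u).
  by rewrite next_cycle // (connect_cycle mono_c) ?mem_next.
have sigma_c u : u \in c -> sigma u \in c.
  move=> u_c; rewrite -(@cycle_succ_unique u (next c u)) ?mem_next ?cB //.
  exact: next_cycle.
(* A dicycle in an old colour is closed under [sigma], so it contains the vertex that [T] picks from
   it, which has the new colour. *)
have : cycle_label v \in cycle_label @: T by rewrite TI imset_f ?cB.
case/imsetP=> t tT /eqP; rewrite cycle_labelE => vt.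
have t_c : t \in c.
  by rewrite -(iter_findex vt); elim: (findex _ _ _) => //= n; apply: sigma_c.
by rewrite T_c // (negPf lmax) in tT.
Qed.

End Colouring.

(** * Reduction to bounded degree and the final bound *)

Lemma bounded_degree_colouring (V : finType) (r : rel V) g :
    irreflexive r -> 2 <= g -> (forall u, total_degree r u < 3 * g) ->
    (forall c, c != [::] -> ucycleb r c -> 2 * g - 1 <= size c) ->
  exists psi : V -> 'I_g.+1, monochromatic_acyclic r psi.
Proof.
move=> r_irr; rewrite leq_eqVlt => /predU1P[<-|g_ge3] deg girth.
  (* For [g = 2] the degree bound [3 * 2] is that of three classes with [k = 2]. *)
  exact: low_degree_colouring.
case: g g_ge3 deg girth => // g g_ge3 deg girth.
have [phi min_phi] := exists_min_energy r (ord0 : 'I_g.+1).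
exact: min_energy_colouring min_phi.
Qed.

(** Since [d < (d %/ (3 * g)).+1 * (3 * g)], the first partition leaves fewer than [3 * g] arcs at
    each vertex inside its class. The digraph [r'] of monochromatic arcs is then coloured once for
    all classes, and the two colourings are paired. *)
Lemma girth_colouring (V : finType) (r : rel V) g d :
    irreflexive r -> 2 <= g -> (forall u, total_degree r u <= d) ->
    (forall c, c != [::] -> ucycleb r c -> 2 * g - 1 <= size c) ->
  exists psi : V -> 'I_(d %/ (3 * g)).+1 * 'I_g.+1, monochromatic_acyclic r psi.
Proof.
move=> r_irr g_ge2 deg girth; set k := d %/ _.
have [phi min_phi] := exists_min_energy r (ord0 : 'I_k.+1).
have deg_phi u : class_degree r phi (phi u) u < 3 * g.
  have g_gt0 : 0 < 3 * g by rewrite muln_gt0 (ltnW g_ge2).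
  rewrite -(prednK g_gt0) ltnS; apply: min_energy_own_degree => //.
  by rewrite card_ord (prednK g_gt0) (leq_ltn_trans (deg u)) // ltn_ceil.
pose r' : rel V := fun a b => r a b && (phi a == phi b).
have [||||psi psiP] := @bounded_degree_colouring V r' g.
- by move=> a; rewrite /r' r_irr.
- by [].
- move=> u; apply: leq_ltn_trans (deg_phi u).
  rewrite /class_degree big_mkcond; apply: leq_sum => w _.
  by rewrite /arcs_between /r' (eq_sym (phi u)); case: (_ == _); rewrite ?andbT ?andbF.
- move=> c c_nil /andP[cyc_c uniq_c]; apply: girth => //; apply/andP; split=> //.
  by apply: sub_cycle cyc_c => a b /andP[].
exists (fun v => (phi v, psi v)) => c [l1 l2] c_nil /andP[cyc_c uniq_c] cl.
apply: (psiP c l2) => // [|v v_c]; last by case: (cl v v_c).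
have c_c : all (mem c) c by apply/allP.
apply/andP; split=> //; apply: sub_in_cycle c_c cyc_c.
move=> a b a_c b_c rab; rewrite /r' rab.
by case: (cl a a_c) => -> _; case: (cl b b_c) => -> _; rewrite eqxx.
Qed.

Lemma dicycle_size_ge_digirth (D : digraph) k (c : seq D) :
  digirth_geq D k -> dicycle c -> k <= size c.
Proof.
rewrite /digirth_geq /digirth; case: decP => [cycD|acD] + cyc_c; last first.
  by case: acD; apply/negP=> /acyclicP/(_ c cyc_c); apply=> x; rewrite inE.
case: ex_minnP => m _ minm km; apply: leq_trans km (minm _ _).
by apply/existsP; exists (in_tuple c).
Qed.

(** The blocks are the nonempty colour classes, so there may be fewer than [#|C|] of them; they are
    counted inside the set [Q] of all classes. *)
Lemma dichromatic_number_le (D : digraph) (C : finType) (psi : D -> C) :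
  monochromatic_acyclic (@Defs.arc D) psi -> dichromatic_number D <= #|C|.
Proof.
move=> psiP; pose P := preim_partition psi [set: D].
have PD : partition P [set: D] := preim_partitionP psi _.
have blockE X : X \in P -> exists x, X = [set y | psi x == psi y].
  by case/imsetP=> x _ ->; exists x; apply/setP=> y; rewrite !inE.
apply: (@leq_trans #|P|).
  rewrite /dichromatic_number; case: ex_minnP => m _; apply.
  apply/existsP; exists P; rewrite eqxx /acyclic_partition PD /=.
  apply/forall_inP=> X /blockE[x ->]; apply/acyclicP=> c /andP[c_nil cyc_c] sub_c.
  by apply: (psiP c (psi x)) => // y /sub_c; rewrite inE => /eqP.
pose Q := [set [set y | psi y == l] | l : C].
apply: (@leq_trans #|Q|); last exact: leq_imset_card.
apply/subset_leq_card/subsetP=> X /blockE[x ->]; apply/imsetP; exists (psi x) => //.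
by apply/setP=> y; rewrite !inE eq_sym.
Qed.

Lemma total_degree_digraph (D : digraph) (v : D) :
  total_degree (@Defs.arc D) v = degree v.
Proof.
rewrite /total_degree /arcs_between big_split /= /degree /outdeg /indeg.
by rewrite -!sum1_card; congr (_ + _); rewrite [RHS]big_mkcond /=;
  apply: eq_bigr => w _; rewrite inE; case: Defs.arc.
Qed.

Import Order.TTheory GRing.Theory Num.Theory.
Local Open Scope ring_scope.

Theorem theorem1 (g : nat) (D : digraph) :
  (2 <= g)%N -> digirth_geq D (2 * g - 1)%N ->
  (dichromatic_number D)%:R <=
    (1 / 3 + 1 / (3 * g%:R)) * (max_degree D)%:R + (g%:R + 1) :> rat.
Proof.
move=> g_ge2 girthD.
have deg (v : D) : (total_degree (@Defs.arc D) v <= max_degree D)%N.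
  by rewrite total_degree_digraph /max_degree leq_bigmax.
have [|psi psiP] := girth_colouring (@arc_irr D) g_ge2 deg.
  by move=> c c_nil cyc_c; apply: dicycle_size_ge_digirth girthD _; apply/andP.
have := dichromatic_number_le psiP; rewrite card_prod !card_ord => chi_le.
have g_gt0 : 0 < g%:R :> rat by rewrite ltr0n (ltnW g_ge2).
set q := (max_degree D %/ (3 * g))%N in chi_le.
have q_le : q%:R * (3 * g%:R) <= (max_degree D)%:R :> rat.
  by rewrite -!natrM ler_nat leq_trunc_div.
apply: (@le_trans _ _ ((q.+1 * g.+1)%:R)); first by rewrite ler_nat.
(* The bound factors, so that only [q <= max_degree D / (3g)] remains after cancelling [g + 1]. *)
have -> : (1 / 3 + 1 / (3 * g%:R)) * (max_degree D)%:R + (g%:R + 1) =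
    ((max_degree D)%:R / (3 * g%:R) + 1) * (g%:R + 1) :> rat.
  by field; rewrite lt0r_neq0.
rewrite natrM -!natr1 ler_pM2r ?addr_gt0 // lerD2r ler_pdivlMr //.
by rewrite mulr_gt0.
Qed.
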